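(* Let $\Sigma$ be a finite alphabet and $w,w'\in\Sigma^*$. Then $w$ and $w'$ are strongly $M$-equivalent if and only if for every $v\in\Sigma^*$ such that $|v|_a\le 1$ for all $a\in\Sigma$, we have $|w|_v=|w'|_v$.
   Context: For words $w,u\in\Sigma^*$, $|w|_u$ is the number of occurrences of $u$ as a scattered subword of $w$ (two occurrences are different iff they differ in at least one position of some letter); $|w|_\lambda=1$ for the empty word $\lambda$. Parikh matrices: for an ordered alphabet $\Gamma=\{a_1<a_2<\dots<a_s\}$, the Parikh matrix mapping $\Psi_\Gamma:\Gamma^*\to\mathcal M_{s+1}$ is the monoid morphism into the multiplicative monoid of $(s+1)\times(s+1)$ upper triangular matrices with nonnegative integer entries and unit diagonal that sends $a_q$ to the matrix with $1$'s on the diagonal, $1$ in position $(q,q+1)$, and $0$ elsewhere. Two words are $M$-equivalent with respect to $\Gamma$ iff they have the same image under $\Psi_\Gamma$. Strong $M$-equivalence: for an (unordered) alphabet $\Sigma$, words $w,w'\in\Sigma^*$ are strongly $M$-equivalent iff they are $M$-equivalent with respect to every ordered alphabet whose underlying set is $\Sigma$. *)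

(* Defs.v *)
From mathcomp Require Import all_boot all_order all_algebra.
Set Implicit Arguments.
Unset Strict Implicit.
Unset Printing Implicit Defensive.
Import GRing.Theory.

(* |w|_u: an occurrence of u as a scattered subword of w is the set of the
   positions of w that it uses, encoded as a bit mask of length |w|. *)
Definition subword_count (A : eqType) (w u : seq A) : nat :=
  #|[set m : (size w).-tuple bool | mask m w == u]|.

(* An ordered alphabet a_1 < ... < a_s whose underlying set is A is the list
   [:: a_1; ...; a_s] of all the letters, each listed once. *)
Definition ordered_alphabet (A : finType) (G : seq A) : Prop :=
  uniq G /\ (forall a : A, a \in G).

Local Open Scope ring_scope.

(* [index] counts from 0, as do matrix coordinates: the extra 1 for the q-th
   letter a_q is in row q and column q + 1 when counting from 1. *)
Definition parikh_letter (A : eqType) (G : seq A) (a : A) :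
    'M[nat]_((size G).+1) :=
  \matrix_(i, j)
    if (i == j) || ((i == index a G :> nat) && (j == (index a G).+1 :> nat))
    then 1 else 0.

Definition parikh_matrix (A : eqType) (G w : seq A) :
    'M[nat]_((size G).+1) :=
  \prod_(a <- w) parikh_letter G a.

Definition M_equiv (A : eqType) (G w w' : seq A) : Prop :=
  parikh_matrix G w = parikh_matrix G w'.

Lemma parikh_matrix_nil (A : eqType) (G : seq A) : parikh_matrix G [::] = 1.
Proof. exact: big_nil. Qed.

Lemma parikh_matrix_cat (A : eqType) (G w w' : seq A) :
  parikh_matrix G (w ++ w') = parikh_matrix G w * parikh_matrix G w'.
Proof. exact: big_cat. Qed.

Lemma parikh_matrix1 (A : eqType) (G : seq A) (a : A) :
  parikh_matrix G [:: a] = parikh_letter G a.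
Proof. exact: big_seq1. Qed.

Lemma parikh_matrix_unitriangular (A : eqType) (G w : seq A)
    (i j : 'I_(size G).+1) :
  (j <= i)%N -> parikh_matrix G w i j = (i == j)%:R.
Proof.
rewrite /parikh_matrix; elim: w i j => [|a w IHw] i j le_ji.
  by rewrite big_nil mxE.
rewrite big_cons mxE (bigD1 i) //= IHw // big1 => [|k neq_ki].
  by rewrite mxE eqxx mul1r addr0.
rewrite mxE eq_sym (negbTE neq_ki) /=; case: ifP => [/andP[/eqP Di /eqP Dk]|_].
  have lt_ik: (i < k)%N by rewrite Dk Di.
  rewrite IHw ?(leq_trans le_ji (ltnW lt_ik)) // -val_eqE /=.
  by rewrite (gtn_eqF (leq_ltn_trans le_ji lt_ik)) mulr0.
by rewrite mul0r.
Qed.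

Definition strongly_M_equiv (A : finType) (w w' : seq A) : Prop :=
  forall G : seq A, ordered_alphabet G -> M_equiv G w w'.

(* Main.v *)
(* The entry of the Parikh matrix of w above the diagonal, in row i and column
   j counted from 0, is the number of occurrences in w of the factor of the
   ordered alphabet that lists its letters from position i to position j - 1.
   Every such factor has distinct letters, and conversely every word with
   distinct letters is a prefix of some ordering of the alphabet, so it is
   counted in the first row of the corresponding Parikh matrix. *)
Require Import Defs.
From mathcomp Require Import all_boot all_algebra.

(** Splitting the masks by their first bit separates the occurrences in [a :: w] that skip the
    leading letter from those that use it. *)
Lemma card_tuple_bool_cons (n : nat) (P : pred (seq bool)) :
  #|[set m : n.+1.-tuple bool | P m]| =
  #|[set m : n.-tuple bool | P (false :: m)]|
    + #|[set m : n.-tuple bool | P (true :: m)]|.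
Proof.
pose S b := [set m : n.-tuple bool | P (b :: m)].
have consI b : injective (fun m : n.-tuple bool => [tuple of b :: m]).
  by move=> m1 m2 /(congr1 val)[eq_m]; apply: val_inj.
rewrite -!/(S _) -(card_imset _ (@consI false)) -(card_imset _ (@consI true)).
(* The added 0 is the size of the intersection of the two images, empty because the head bits
   differ. *)
rewrite -cardsUI -[LHS]addn0; congr addn; last first.
  apply/esym/eqP; rewrite cards_eq0 -subset0; apply/subsetP=> m.
  by rewrite inE => /andP[/imsetP[m1 _ ->] /imsetP[m2 _ /(congr1 val)]].
apply: eq_card => m; rewrite !inE; apply/idP/idP.
  case/tupleP: m => b m Pm; apply/orP; case: b Pm => Pm; [right | left].
    by apply/imsetP; exists m; rewrite ?inE.
  by apply/imsetP; exists m; rewrite ?inE.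
by case/orP=> /imsetP[m' + ->]; rewrite inE.
Qed.

Section SubwordCount.

Variable A : eqType.
Implicit Types (a b : A) (w u v G : seq A).

Lemma subword_count_nil u : subword_count [::] u = (u == [::]).
Proof.
rewrite /subword_count; case: eqP => [-> | nz_u].
  rewrite -[RHS](card_tuple 0 bool) -cardsT; apply: eq_card => m.
  by rewrite !inE mask0 eqxx.
by apply: eq_card0 => m; rewrite inE mask0 eq_sym; apply/eqP.
Qed.

Lemma subword_count_cons0 a w :
  subword_count (a :: w) [::] = subword_count w [::].
Proof.
rewrite /subword_count (card_tuple_bool_cons _ (fun m => mask m (a :: w) == _)).
by rewrite [X in _ + X]eq_card0 ?addn0 // => m; rewrite inE.
Qed.

Lemma subword_count0 w : subword_count w [::] = 1.
Proof.
by elim: w => [|a w IHw]; rewrite ?subword_count_nil // subword_count_cons0.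
Qed.

Lemma subword_count_cons a w b u :
  subword_count (a :: w) (b :: u) =
  subword_count w (b :: u) + (a == b) * subword_count w u.
Proof.
rewrite /subword_count (card_tuple_bool_cons _ (fun m => mask m (a :: w) == _)).
congr addn => /=; case: eqP => [-> | neq_ab].
  by rewrite mul1n; apply: eq_card => m; rewrite !inE eqseq_cons eqxx.
by apply: eq_card0 => m; rewrite inE eqseq_cons; move/eqP/negbTE: neq_ab => ->.
Qed.

Lemma subword_count_letter w a : subword_count w [:: a] = count_mem a w.
Proof.
elim: w => [|b w IHw]; first by rewrite subword_count_nil.
by rewrite subword_count_cons subword_count0 IHw muln1 addnC.
Qed.

Lemma uniq_subword_countP v :
  reflect (forall a, subword_count v [:: a] <= 1) (uniq v).
Proof.
apply: (iffP idP) => [Uv a | v_le1].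
  by rewrite subword_count_letter count_uniq_mem // leq_b1.
apply/count_mem_uniq => a; have := v_le1 a.
rewrite subword_count_letter -has_pred1 has_count.
by case: (count_mem a v) => [|[]].
Qed.

(** Left multiplication by [parikh_letter G a] adds to row [index a G] the row below it. The [insub]
    test gives 0 when there is no row below, as for a letter outside [G], whose index is
    [size G]. *)
Lemma parikh_matrix_cons G a w (i j : 'I_(size G).+1) :
  parikh_matrix G (a :: w) i j =
  parikh_matrix G w i j
    + (if i == index a G :> nat then
         if insub i.+1 is Some k then parikh_matrix G w k j else 0
       else 0).
Proof.
rewrite /parikh_matrix big_cons mxE (bigD1 i) //= mxE eqxx GRing.mul1r.
congr addn; have [Di | neq_ia] := eqVneq (i : nat) (index a G); last first.
  apply: big1 => k neq_ki; rewrite mxE eq_sym (negbTE neq_ki) (negbTE neq_ia).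
  by rewrite GRing.mul0r.
case: insubP => [k _ Dk | /negP out].
  rewrite (bigD1 k) /=; last by rewrite -val_eqE /= Dk gtn_eqF.
  rewrite mxE Di Dk Di !eqxx orbT GRing.mul1r [X in (_ + X)%R]big1 ?GRing.addr0 // => l.
  case/andP=> neq_li neq_lk; rewrite mxE eq_sym (negbTE neq_li) -Di -Dk.
  by rewrite eqxx -val_eqE in neq_lk *; rewrite /= (negbTE neq_lk) GRing.mul0r.
apply: big1 => k neq_ki; rewrite mxE eq_sym (negbTE neq_ki) /=.
case: ifP => [/andP[_ /eqP Dk] | _]; last exact: GRing.mul0r.
by case: out; rewrite Di -Dk.
Qed.

(** Induction on [w]: above the diagonal, [parikh_matrix_cons] and [subword_count_cons] are the same
    recurrence, since dropping the first letter of the factor moves its start from [i] to [i.+1]. *)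
Lemma parikh_matrixE G w (i j : 'I_(size G).+1) :
  uniq G -> i <= j ->
  parikh_matrix G w i j = subword_count w (take (j - i) (drop i G)).
Proof.
move=> UG; elim: w i => [|a w IHw] i le_ij; move: (le_ij).
  rewrite parikh_matrix_nil mxE subword_count_nil -size_eq0 size_take_min.
  rewrite size_drop (minn_idPl (leq_sub2r _ (leq_ord j))) subn_eq0.
  by move=> le_ij'; rewrite -val_eqE eqn_leq /= le_ij'; case: (j <= i).
(* On the diagonal the factor is empty and has no first letter to compare with [a]. *)
rewrite leq_eqVlt => /predU1P[Dij | lt_ij].
  rewrite Dij subnn take0 subword_count0 parikh_matrix_unitriangular ?Dij //.
  by rewrite -val_eqE /= Dij eqxx.
have lt_iG: i < size G := leq_trans lt_ij (leq_ord j).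
have x0 : A by move: lt_iG; move: (i : nat) => n; case: (G).
rewrite parikh_matrix_cons insubT IHw // (drop_nth x0) // -subSS subSn //=.
rewrite subword_count_cons; congr addn; rewrite IHw //=.
(* Row [i] changes exactly when the factor begins with [a]; this uses that the letters of [G] are
   distinct. *)
have -> : (i == index a G :> nat) = (a == nth x0 G i).
  apply/eqP/eqP=> [Di | ->]; last by rewrite index_uniq.
  by rewrite Di nth_index // -index_mem -Di.
by case: (a == _); rewrite ?mul1n ?mul0n.
Qed.

End SubwordCount.

(** The letters missing from [v] are appended in the order of [enum A]. *)
Lemma ordered_alphabet_prefix (A : finType) (v : seq A) :
  uniq v -> ordered_alphabet (v ++ [seq a <- enum A | a \notin v]).
Proof.
move=> Uv; split=> [|a]; last first.
  by rewrite mem_cat mem_filter mem_enum andbT orbN.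
rewrite cat_uniq Uv filter_uniq ?enum_uniq // andbT.
by apply/hasPn=> a; rewrite mem_filter => /andP[].
Qed.

Theorem theorem3p3 (A : finType) (w w' : seq A) :
  strongly_M_equiv w w' <->
  (forall v : seq A,
     (forall a : A, subword_count v [:: a] <= 1) ->
     subword_count w v = subword_count w' v).
Proof.
split=> [eq_ww' v /uniq_subword_countP Uv | eq_ww' G [UG _]].
  have ordG := ordered_alphabet_prefix A v Uv; have [UG _] := ordG.
  set G := v ++ _ in ordG UG.
  have lt_vG : size v < (size G).+1 by rewrite ltnS size_cat leq_addr.
  (* Row 0 and column [size v] select the prefix of [G] of length [size v], which is [v]. *)
  have := eq_ww' G ordG; rewrite /M_equiv => /matrixP/(_ ord0 (Ordinal lt_vG)).
  by rewrite !parikh_matrixE //= subn0 drop0 take_size_cat.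
apply/matrixP=> i j; have [le_ij | lt_ji] := leqP i j; last first.
  by rewrite !parikh_matrix_unitriangular // ltnW.
rewrite !parikh_matrixE //; apply/eq_ww'/uniq_subword_countP.
by rewrite take_uniq ?drop_uniq.
Qed.
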